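(* Let $G$ be a countably infinite group. Then there are exactly $2^{\omega}$ coarse subsets of $G$; that is, the set of equivalence classes of non-empty subsets of $G$ under the relation of coarse equivalence (each non-empty subset of $G$ being regarded as a subballean of the ballean $(G,\mathfrak{F}_G,B)$) has cardinality $2^{\omega}$.
   Context: A ball structure is a triple $\mathcal{B}=(X,P,B)$, where $X,P$ are non-empty sets and, for all $x\in X$ and $\alpha\in P$, $B(x,\alpha)$ is a subset of $X$ with $x\in B(x,\alpha)$, called the ball of radius $\alpha$ around $x$. The set $X$ is called the support of $\mathcal{B}$ and $P$ the set of radii. For $x\in X$, $A\subseteq X$, $\alpha\in P$ put $B^*(x,\alpha)=\{y\in X: x\in B(y,\alpha)\}$ and $B(A,\alpha)=\bigcup_{a\in A}B(a,\alpha)$. A ball structure is a ballean if: (1) for any $\alpha,\beta\in P$ there exist $\alpha',\beta'\in P$ such that, for every $x\in X$, $B(x,\alpha)\subseteq B^*(x,\alpha')$ and $B^*(x,\beta)\subseteq B(x,\beta')$; (2) for any $\alpha,\beta\in P$ there exists $\gamma\in P$ such that, for every $x\in X$, $B(B(x,\alpha),\beta)\subseteq B(x,\gamma)$; (3) for any $x,y\in X$ there exists $\alpha\in P$ such that $y\in B(x,\alpha)$. Let $\mathcal{B}=(X,P,B)$ and $\mathcal{B}'=(X',P',B')$ be balleans. A mapping $f:X\to X'$ is coarse if for every $\alpha\in P$ there exists $\alpha'\in P'$ such that, for every $x\in X$, $f(B(x,\alpha))\subseteq B'(f(x),\alpha')$. A bijection $f:X\to X'$ is an asymorphism if both $f$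 and $f^{-1}$ are coarse; in this case $\mathcal{B}$ and $\mathcal{B}'$ are called asymorphic. Each non-empty subset $Y\subseteq X$ defines the subballean $\mathcal{B}_Y=(Y,P,B_Y)$, where $B_Y(y,\alpha)=Y\cap B(y,\alpha)$. A subset $Y\subseteq X$ is large (in $\mathcal{B}$) if $X=B(Y,\alpha)$ for some $\alpha\in P$. Balleans $\mathcal{B}$ and $\mathcal{B}'$ with supports $X$ and $X'$ are coarsely equivalent if there exist large subsets $Y\subseteq X$ and $Y'\subseteq X'$ (large in $\mathcal{B}$ and $\mathcal{B}'$ respectively) such that the subballeans $\mathcal{B}_Y$ and $\mathcal{B}'_{Y'}$ are asymorphic. Every infinite group $G$ is considered as the ballean $(G,\mathfrak{F}_G,B)$, where $\mathfrak{F}_G$ is the family of all finite subsets of $G$ and $B(g,F)=Fg\cup\{g\}$ for $g\in G$, $F\in\mathfrak{F}_G$. Each non-empty subset of $G$ is considered as a subballean of $G$, and two non-empty subsets of $G$ are coarsely equivalent if the corresponding subballeans are coarsely equivalent. A coarse subset of $G$ is a class of all pairwise coarsely equivalent non-empty subsets of $G$, i.e. an equivalence class under coarse equivalence. Here $2^{\omega}$ denotes the cardinality of the continuum. *)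

(* Defs.v *)
From mathcomp Require Import all_boot finmap.
From mathcomp Require Import boolp classical_sets functions cardinality.

Set Implicit Arguments.
Unset Strict Implicit.
Unset Printing Implicit Defensive.

Local Open Scope classical_set_scope.

Record ballStructure := BallStructure {
  support :> Type;
  radii : Type;
  bball : support -> radii -> set support;
  support_nonempty : inhabited support;
  radii_nonempty : inhabited radii;
  bball_center : forall x a, bball x a x }.

Definition bstar (B : ballStructure) (x : B) (a : radii B) : set B :=
  [set y | bball y a x].

Definition bball_set (B : ballStructure) (A : set B) (a : radii B) : set B :=
  \bigcup_(x in A) bball x a.

Definition ballean_axiom (B : ballStructure) : Prop :=
  [/\ forall a b : radii B, exists a' b' : radii B, forall x : B,
        bball x a `<=` bstar x a' /\ bstar x b `<=` bball x b',
      forall a b : radii B, exists c : radii B, forall x : B,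
        bball_set (bball x a) b `<=` bball x c
    & forall x y : B, exists a : radii B, bball x a y].

Record ballean := Ballean {
  ballean_structure :> ballStructure;
  balleanP : ballean_axiom ballean_structure }.

Definition coarse (B B' : ballStructure) (f : B -> B') : Prop :=
  forall a : radii B, exists a' : radii B', forall x : B,
    f @` bball x a `<=` bball (f x) a'.

Definition asymorphism (B B' : ballStructure) (f : B -> B') : Prop :=
  exists g : B' -> B, [/\ cancel f g, cancel g f, coarse f & coarse g].

Definition asymorphic (B B' : ballStructure) : Prop :=
  exists f : B -> B', asymorphism f.

Section Subballean.
Variables (B : ballean) (Y : set B).
Hypothesis Y0 : Y !=set0.

Lemma set_type_inhabited : inhabited Y.
Proof. by case: Y0 => y Yy; exists; exists y; rewrite inE. Qed.

(* The support is the type of the elements of [Y], so that [Y `&` bball y a]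
   becomes the preimage of [bball y a] under the inclusion. *)
Definition sub_ball (y : Y) (a : radii B) : set Y :=
  val @^-1` bball (val y) a.

Lemma sub_ball_center (y : Y) (a : radii B) : sub_ball y a y.
Proof. exact: bball_center. Qed.

Definition sub_ballStructure : ballStructure :=
  BallStructure set_type_inhabited (radii_nonempty B) sub_ball_center.

Lemma sub_balleanP : ballean_axiom sub_ballStructure.
Proof.
have [h1 h2 h3] := balleanP B; split.
- move=> a b; have [a' [b' h]] := h1 a b; exists a', b' => x.
  by have [ha hb] := h (val x); split=> y; [apply: ha | apply: hb].
- move=> a b; have [c h] := h2 a b; exists c => x y [z xz zy].
  by apply: h; exists (val z).
- by move=> x y; apply: h3.
Qed.

Definition subballean : ballean := Ballean sub_balleanP.

End Subballean.

Definition large (B : ballStructure) (Y : set B) : Prop :=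
  exists a : radii B, bball_set Y a = [set: B].

Definition coarsely_equivalent (B B' : ballean) : Prop :=
  exists (Y : set B) (Y' : set B') (Y0 : Y !=set0) (Y'0 : Y' !=set0),
    [/\ large Y, large Y' & asymorphic (subballean Y0) (subballean Y'0)].

Section GroupBallean.
Variable G : groupType.
Local Open Scope group_scope.

Definition group_ball (g : G) (F : {fset G}) : set G :=
  [set f * g | f in [set` F]] `|` [set g].

Lemma group_ball_center g F : group_ball g F g.
Proof. by right. Qed.

Definition group_ballStructure : ballStructure :=
  BallStructure (inhabits (1 : G)) (inhabits (fset0 : {fset G}))
    group_ball_center.

Lemma group_balleanP : ballean_axiom group_ballStructure.
Proof.
have ball_inv (F : {fset G}) : exists F' : {fset G}, forall x y : G,
    group_ball x F y -> group_ball y F' x.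
  exists [fset f^-1 | f in F]%fset => x y [[f /= fF <-]|->]; last by right.
  by left; exists f^-1; rewrite ?mulKg//=; apply/imfsetP; exists f.
split.
- move=> a b; have [a' ha] := ball_inv a; have [b' hb] := ball_inv b.
  by exists a', b' => x; split=> y; [apply: ha | apply: hb].
- move=> a b.
  exists [fset f' * f | f' in (1 |` b)%fset, f in (1 |` a)%fset]%fset => x z.
  have ballE (F : {fset G}) (u v : G) : group_ball u F v ->
      exists2 f, f \in (1 |` F)%fset & v = f * u.
    case=> [[f /= fF <-]|->]; first by exists f; rewrite // in_fset1U fF orbT.
    by exists 1; rewrite ?mul1g// in_fset1U eqxx.
  case=> y /ballE[f fa ->] /ballE[f' f'b ->]; left.
  by exists (f' * f); rewrite ?mulgA//=; apply/imfset2P; exists f' => //; exists f.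
- move=> x y; exists [fset y * x^-1]%fset; left.
  by exists (y * x^-1); rewrite ?mulgVK//= inE.
Qed.

Definition group_ballean : ballean := Ballean group_balleanP.

Definition nonempty_subset : Type := {A : set G | A !=set0}.

Definition subset_ballean (A : nonempty_subset) : ballean :=
  @subballean group_ballean (proj1_sig A) (proj2_sig A).

Definition coarse_class (A : nonempty_subset) : set nonempty_subset :=
  [set A' | coarsely_equivalent (subset_ballean A) (subset_ballean A')].

Definition coarse_subsets : set (set nonempty_subset) := range coarse_class.

End GroupBallean.

Arguments coarse_subsets G : clear implicits.

(* Main.v *)
Require Import Defs.
From mathcomp Require Import all_boot finmap.
From mathcomp Require Import boolp classical_sets functions cardinality.

Local Open Scope classical_set_scope.
Local Open Scope card_scope.

Set Implicit Arguments.
Unset Strict Implicit.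
Unset Printing Implicit Defensive.

(** Take finite sets [P 0], [P 1], ... of rapidly growing size, each [P n] being
    covered by translates of [P m] for [m <= n], and translates
    [K i = P (u i) * x i] that drift apart from one another, every type
    [k = u i] occurring infinitely often. A set [S] of labels selects the
    union of the blocks [K i] with [u (u i)] in [S].
    Let [R] be an asymorphism between large subsets of two such unions. For
    [i] large among the blocks of type [k], [R] sends the surviving part of
    [K i] into one block [K j], of type [t] say, and the points of [K j] near
    that image come back into [K i]. Largeness loses only bounded factors, so
    the sizes of [P k] and [P t] are comparable and [t = k] once [k] is large.
    Hence the label of [K i] is selected on both sides. The tiling of [P t] by
    translates of [P (k + 1)] is needed because [t] is not bounded a priori,
    so that coarseness of the inverse only controls bounded pieces of [K j]. *)

Lemma fset_bounded (K : choiceType) (F : {fset K}) (c : K -> nat) :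
  exists N, forall x, x \in F -> c x < N.
Proof.
exists (\max_(x <- F) c x).+1 => x xF; rewrite ltnS.
exact: (@leq_bigmax_seq _ _ xpredT c x).
Qed.

(** Multiply [2 ^ k] by a large odd number. This makes [logn 2] a possible choice of the type
    function [u]. *)
Lemma logn2_fiber k N : exists2 i, N <= i & logn 2 i = k.
Proof.
exists (2 ^ k * N.*2.+1)%N.
  by rewrite (leq_trans _ (leq_pmull _ _)) ?expn_gt0// -addnn -addnS leq_addr.
rewrite lognM ?expn_gt0// pfactorK// [X in (_ + X)%N]logn_coprime ?addn0//.
by rewrite prime_coprime// dvdn2 /= odd_double.
Qed.

Section Group.
Variable G : groupType.
Local Open Scope group_scope.
Implicit Types (A B F : {fset G}) (R : G -> G -> Prop).

Definition fset_prod A B : {fset G} := [fset a * b | a in A, b in B]%fset.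
Definition fset_inv A : {fset G} := [fset a^-1 | a in A]%fset.

Lemma mem_fset_prod A B a b : a \in A -> b \in B -> a * b \in fset_prod A B.
Proof. by move=> aA bB; apply/imfset2P; exists a => //; exists b. Qed.

Lemma fset_prodP A B g :
  reflect (exists a b, [/\ a \in A, b \in B & g = a * b]) (g \in fset_prod A B).
Proof.
apply: (iffP idP) => [/imfset2P[a aA [b bB ->]]|[a [b [aA bB ->]]]].
  by exists a, b.
exact: mem_fset_prod.
Qed.

Lemma mem_fset_inv A a : a \in A -> a^-1 \in fset_inv A.
Proof. by move=> aA; apply/imfsetP; exists a. Qed.

Lemma mem_fset_div A a b :
  a \in A -> b \in A -> a * b^-1 \in fset_prod A (fset_inv A).
Proof. by move=> aA bA; apply: mem_fset_prod (mem_fset_inv _). Qed.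

Definition tower (P : nat -> {fset G}) : Prop :=
  [/\ forall m, 0 < #|` P m|,
      forall m, m.+1 * #|` P m| <= #|` P m.+1|,
      forall m n, m <= n -> (P m `<=` P n)%fset
    & forall m n g, m <= n -> g \in P n -> exists z,
        (exists2 p, p \in P m & g = p * z) /\
        (forall p, p \in P m -> p * z \in P n)].

(** Balls are sets [F * p], so [q * p^-1] acts as the distance; right translation preserves it. *)
Definition scattered (K : nat -> {fset G}) : Prop :=
  forall F, exists N, forall i j p q,
    p \in K i -> q \in K j -> q * p^-1 \in F -> i = j \/ i < N /\ j < N.

(* [coarse_graph A R] together with [coarse_graph A' R^T] says that [R] is the
   graph of an asymorphism between large subsets of [A] and [A']. *)
Definition coarse_graph (A : set G) (R : G -> G -> Prop) : Prop :=
  [/\ forall x x', R x x' -> A x,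
      forall x x' x'', R x x' -> R x x'' -> x' = x'',
      forall F, exists F' : {fset G}, forall x x' y y', R x x' -> R y y' ->
        y * x^-1 \in F -> y' * x'^-1 \in F'
    & exists F, forall x, A x -> exists y y', R y y' /\ x * y^-1 \in F].

(** * Construction of towers and of scattered translates *)

Section Enumerated.
Variables (e : nat -> G) (c : G -> nat).
Hypotheses (eK : cancel e c) (cK : cancel c e).

Lemma fset_of_card n : exists A, #|` A| = n.
Proof.
exists [fset e i | i in iota 0 n]%fset.
rewrite card_in_imfset/= ?undup_id ?iota_uniq ?size_iota// => x y _ _.
exact: (can_inj eK).
Qed.

Lemma fset_fresh A : exists g, g \notin A.
Proof.
have [N hN] := fset_bounded A c; exists (e N); apply/negP => /hN.
by rewrite eK ltnn.
Qed.

(** Multiplying [P m] on the right by a finite set gives a union of translates of [P m]; as 1 lies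
    in [P m], the product also contains the whole pool, which forces growth. *)
Lemma tower_exists : exists P, tower P.
Proof.
have [pool poolE] := choice fset_of_card.
pose next m A := fset_prod A (1 |` pool (m.+1 * #|` A|)%N)%fset.
pose P := fix P n := if n is m.+1 then next m (P m) else [fset 1]%fset.
have subS m : (P m `<=` P m.+1)%fset.
  apply/fsubsetP => g gP; rewrite -(mulg1 g).
  by apply: mem_fset_prod => //; rewrite in_fset1U eqxx.
have mono m n : m <= n -> (P m `<=` P n)%fset.
  elim: n => [|n IHn]; first by rewrite leqn0 => /eqP->.
  rewrite leq_eqVlt => /orP[/eqP->//|]; rewrite ltnS => /IHn mn.
  exact: fsubset_trans mn (subS n).
have P1 m : 1 \in P m by apply: (fsubsetP (mono 0 m _)); rewrite // in_fset1.
exists P; split => //.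
- by move=> m; rewrite cardfs_gt0; apply/fset0Pn; exists 1.
- move=> m; rewrite -{1}[X in X <= _]poolE fsubset_leq_card//.
  apply/fsubsetP => g gpool; rewrite -(mul1g g).
  by apply: mem_fset_prod; rewrite // in_fset1U gpool orbT.
- move=> m n g; elim: n g => [|n IHn] g.
    rewrite leqn0 => /eqP-> gP; exists 1.
    by split=> [|p pP]; [exists g; rewrite ?mulg1|rewrite mulg1].
  rewrite leq_eqVlt => /orP[/eqP-> gP|].
    exists 1.
    by split=> [|p pP]; [exists g; rewrite ?mulg1|rewrite mulg1].
  rewrite ltnS => mn /fset_prodP[a [b [/(IHn _ mn)[z [[p pP ->] zP]] bE ->]]].
  exists (z * b); split=> [|q qP]; first by exists p; rewrite // mulgA.
  by rewrite mulgA mem_fset_prod// zP.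
Qed.

(** Greedy choice: quotients of block [i] by earlier blocks get index at least [i] under [c], while
    [c] is bounded on each finite set. *)
Lemma scattered_exists (D : nat -> {fset G}) :
  exists x : nat -> G, scattered (fun i => [fset d * x i | d in D i]%fset).
Proof.
have /choice[next nextP] (nU : nat * {fset G}) : exists y : G,
    forall d p, d \in D nU.1 -> p \in nU.2 -> nU.1 <= c (d * y * p^-1).
  case: nU => n U /=.
  pose Fn := [fset e i | i in iota 0 n]%fset.
  (* Only finitely many [y] are bad: [d * y * p^-1 = f] forces [y = d^-1 * f * p]. *)
  have [y yN] := fset_fresh (fset_prod (fset_inv (D n)) (fset_prod Fn U)).
  exists y => d p dD pU; rewrite leqNgt; apply/negP => clt.
  case/negP: yN; rewrite -(mulKg d y) -(mulgVK p (d * y)).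
  apply: mem_fset_prod (mem_fset_inv dD) (mem_fset_prod _ pU).
  by apply/imfsetP; exists (c (d * y * p^-1)); rewrite /= ?cK ?mem_iota.
pose block i y := [fset d * y | d in D i]%fset.
pose U := fix U n :=
  if n is m.+1 then (U m `|` block m (next (m, U m)))%fset else fset0.
pose x n := next (n, U n); exists x.
have subU i j : j < i -> (block j (x j) `<=` U i)%fset.
  elim: i => // i IHi; rewrite ltnS leq_eqVlt => /orP[/eqP->|/IHi ji] /=.
    exact: fsubsetUr.
  exact: fsubset_trans ji (fsubsetUl _ _).
have far i j p q : j < i -> p \in block j (x j) -> q \in block i (x i) ->
    i <= c (q * p^-1).
  move=> ji /(fsubsetP (subU _ _ ji)) pU /imfsetP[d /= dD ->].
  exact: (nextP (i, U i)).
(* [far] has the later block in the numerator; the inverses handle the other order. *)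
move=> F; have [N hN] := fset_bounded (F `|` fset_inv F)%fset c.
exists N => i j p q pK qK qpF.
have [ij|ji|->] := ltngtP i j; last by left.
- right; have jN : j < N.
    by apply: leq_ltn_trans (far _ _ _ _ ij pK qK) (hN _ _); rewrite in_fsetU qpF.
  by split=> //; apply: ltn_trans jN.
- right; have iN : i < N.
    apply: leq_ltn_trans (far _ _ _ _ ji qK pK) (hN _ _).
    by rewrite in_fsetU -[p * _]invgK invgM invgK mem_fset_inv ?orbT.
  by split=> //; apply: ltn_trans iN.
Qed.

End Enumerated.

(** * Rigidity of the blocks *)

Lemma card_le_graph A F K R :
    (forall x x' x'', R x x' -> R x x'' -> x' = x'') ->
    (forall g, g \in A -> exists w w', [/\ w \in K, R w w' & g * w'^-1 \in F]) ->
  #|` A| <= #|` F| * #|` K|.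
Proof.
move=> Rfun AK.
have /choice[f fP] w : exists w', forall w'', R w w'' -> w'' = w'.
  have [[w' Rww']|nR] := pselect (exists w', R w w').
    by exists w' => w'' Rww''; apply: Rfun Rww'' Rww'.
  by exists 1 => w'' Rww''; case: nR; exists w''.
rewrite -(size_allpairs (fun b w => b * f w)).
apply: uniq_leq_size (fset_uniq _) _ => g /AK[w [w' [wK Rww' gF]]].
rewrite -(mulgVK w' g) (fP _ _ Rww').
by apply/allpairsP; exists (g * (f w)^-1, w); rewrite -(fP _ _ Rww').
Qed.

(** Finitely many points lie in blocks below [M]. Each has at most one preimage under [R], and
    scatteredness for [F = {1}] bounds the indices of the blocks containing it. *)
Lemma scattered_escape (K : nat -> {fset G}) R M : scattered K ->
    (forall y x x', R x y -> R x' y -> x = x') ->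
  exists N, forall i j p p',
    N <= i -> p \in K i -> p' \in K j -> R p p' -> M <= j.
Proof.
move=> Kscat Rinj.
have /choice[b bP] p' : exists N, forall i p, p \in K i -> R p p' -> i < N.
  have [N hN] := Kscat [fset 1]%fset.
  have [[i0 [p0 [p0K Rp0]]]|nR] := pselect (exists i p, p \in K i /\ R p p').
    exists (maxn N i0.+1) => i p pK Rp.
    rewrite (Rinj _ _ _ Rp Rp0) in pK.
    have [|->|[iN _]] := hN _ _ _ _ pK p0K; first by rewrite mulgV in_fset1.
      by rewrite leq_max leqnn orbT.
    by rewrite leq_max iN.
  by exists 0 => i p pK Rp; case: nR; exists i, p.
have [N hN] := fset_bounded (\bigcup_(j <- iota 0 M) K j)%fset b.
exists N => i j p p' Ni pK p'K Rp; rewrite leqNgt; apply/negP => jM.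
have /hN : p' \in (\bigcup_(j <- iota 0 M) K j)%fset.
  by apply/bigfcupP; exists j; rewrite // mem_iota jM.
by rewrite ltnNge (leq_trans Ni)// ltnW// (bP _ _ _ pK Rp).
Qed.

Lemma block_match (P : nat -> {fset G}) (u : nat -> nat) (x : nat -> G) :
    let K i := [fset p * x i | p in P (u i)]%fset in
    let union S := [set g | exists2 i, S (u (u i)) & g \in K i] in
    tower P -> scattered K -> (forall k N, exists2 i, N <= i & u i = k) ->
  forall (S T : set nat) R,
    coarse_graph (union S) R -> coarse_graph (union T) (fun y y' => R y' y) ->
    S `<=` T.
Proof.
move=> K union [P0 Pgrow Pmono Ptiles] Kscat ufib S T R.
move=> [Rdom Rfun Rcoarse [a Rlarge]] [Rcod Rinj Rcocoarse [a' Rcolarge]] n Sn.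
have cardK i : #|` K i| = #|` P (u i)|.
  by rewrite card_imfset//=; apply: mulIg.
(* Labels are [u (u i)], so label [n] has a type [k] so large that tower growth outweighs both
   largeness constants. *)
have [k ak uk] := ufib n (#|` a| + #|` a'|).+1.
pose diff m := fset_prod (P m) (fset_inv (P m)).
have Kdiff i y z : y \in K i -> z \in K i -> z * y^-1 \in diff (u i).
  move=> /imfsetP[p /= pP ->] /imfsetP[q /= qP ->].
  by rewrite invgM mulgA mulgK mem_fset_div.
have [F0 F0P] := Rcoarse (diff k).
have [F1 F1P] := Rcocoarse (fset_prod (fset_inv a') (diff k.+1)).
have [Na NaP] := Kscat a; have [Na' Na'P] := Kscat a'.
have [N0 N0P] := Kscat F0; have [N1 N1P] := Kscat F1.
(* Past these thresholds the exceptional case of [scattered] is excluded, for [i] directly and for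
   its image block [j] by escape. *)
have [Ne NeP] := scattered_escape (maxn Na' N0) Kscat Rinj.
have [i + ui] := ufib k (maxn Ne (maxn Na N1)).
rewrite !geq_max => /and3P[Nei Nai N1i].
have Klarge p : p \in K i -> exists y y',
    [/\ y \in K i, R y y' & p * y^-1 \in a].
  move=> pK; have [|y [y' [Ryy' pya]]] := Rlarge p.
    by exists i; rewrite // ui uk.
  have [j _ yK] := Rdom _ _ Ryy'.
  have [ji|[_]] := NaP _ _ _ _ yK pK pya; last by rewrite ltnNge Nai.
  by exists y, y'; rewrite -{1}ji.
have [p0 p0K] : exists p, p \in K i.
  by apply/fset0Pn; rewrite -cardfs_gt0 cardK.
have [y [y' [yK Ryy' _]]] := Klarge _ p0K.
have [j Tj y'K] := Rcod _ _ Ryy'.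
have := NeP _ _ _ _ Nei yK y'K Ryy'; rewrite geq_max => /andP[Na'j N0j].
suff tk : u j = k by rewrite -uk -tk.
set t := u j in Tj *.
have image_in z z' : z \in K i -> R z z' -> z' \in K j.
  move=> zK Rzz'; have [l _ z'K] := Rcod _ _ Rzz'.
  have [|->|[+ _]] // := N0P _ _ _ _ y'K z'K.
    by apply: F0P Ryy' Rzz' _; rewrite -ui; apply: Kdiff.
  by rewrite ltnNge N0j.
have le_kt : #|` P k| <= #|` a| * #|` P t|.
  rewrite -ui -!cardK; apply: (card_le_graph (R := fun y y' => R y' y)) => //.
  move=> p /Klarge[z [z' [zK Rzz' pza]]]; exists z', z; split => //.
  exact: image_in Rzz'.
(* [q] runs over a translate of [P (minn k.+1 t)] inside [K j] that contains
   [y'], a piece whose diameter is bounded independently of [j]. *)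
have le_tk : #|` P (minn k.+1 t)| <= #|` a'| * #|` P k|.
  set m := minn k.+1 t.
  have /imfsetP[b /= bP y'E] := y'K.
  have [z [[p pP bE] zP]] := Ptiles m t b (geq_minr _ _) bP.
  have -> : #|` P m| = #|` [fset q * (z * x j) | q in P m]%fset|.
    by rewrite card_imfset//=; apply: mulIg.
  rewrite -ui -cardK; apply: (card_le_graph (R := R)) => //.
  move=> _ /imfsetP[q /= qP ->].
  have qK : q * (z * x j) \in K j.
    by rewrite mulgA; apply/imfsetP; exists (q * z); rewrite //= zP.
  have [|w' [w [Rww' qwa]]] := Rcolarge (q * (z * x j)); first by exists j.
  have [l _ w'K] := Rcod _ _ Rww'.
  have [lj|[_]] := Na'P _ _ _ _ w'K qK qwa; last by rewrite ltnNge Na'j.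
  have [h _ wK] := Rdom _ _ Rww'.
  have [|ih|[+ _]] := N1P _ _ _ _ yK wK; last by rewrite ltnNge N1i.
    apply: F1P Ryy' Rww' _.
    (* The path from [y'] to [w'] goes through the point of the tile given by [q]. *)
    have -> : w' * y'^-1 =
        (q * (z * x j) * w'^-1)^-1 * (q * (z * x j) * y'^-1).
      by rewrite invgM invgK mulgA mulgVK.
    apply: mem_fset_prod (mem_fset_inv qwa) _.
    rewrite y'E bE -(mulgA p) invgM mulgA mulgK.
    by apply: mem_fset_div; apply: (fsubsetP (Pmono m _ _)); rewrite ?geq_minl.
  by exists w, w'; rewrite ih.
(* If [k < t], [le_tk] bounds the growth from [P k] to [P k.+1] by the size of [a']; if [t < k],
   [le_kt] bounds that from [P k.-1] to [P k] by the size of [a]. Both contradict [Pgrow]. *)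
apply/eqP; rewrite eqn_leq; apply/andP; split; rewrite leqNgt; apply/negP.
- move=> kt; move: le_tk; rewrite (minn_idPl kt) leqNgt => /negP; apply.
  apply: leq_trans (Pgrow k); rewrite ltn_pmul2r// ltnS ltnW//.
  by rewrite (leq_ltn_trans (leq_addl _ _) ak).
- move=> tk; move: le_kt; rewrite leqNgt => /negP; apply.
  have -> : k = k.-1.+1 by rewrite prednK// (leq_ltn_trans _ tk).
  have tk1 : #|` P t| <= #|` P k.-1|.
    by rewrite fsubset_leq_card// Pmono// -ltnS prednK// (leq_ltn_trans _ tk).
  apply: leq_trans (Pgrow k.-1); rewrite prednK ?(leq_ltn_trans _ tk)//.
  apply: (@leq_ltn_trans (#|` a| * #|` P k.-1|)).
    by rewrite leq_mul2l tk1 orbT.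
  by rewrite ltn_pmul2r// (leq_ltn_trans (leq_addr _ _) ak).
Qed.

(** * From coarse equivalence to graphs *)

Lemma group_ballP (g h : G) F : group_ball g F h <-> h * g^-1 \in (1 |` F)%fset.
Proof.
rewrite in_fset1U; split=> [[[f /= fF <-]|->]|/orP[/eqP hg|hF]].
- by rewrite mulgK fF orbT.
- by rewrite mulgV eqxx.
- by right; rewrite /= -(mulgVK g h) hg mul1g.
- by left; exists (h * g^-1); rewrite ?mulgVK.
Qed.

(** Describing [R] by an equivalence lets the lemma apply also to the inverse map with the
    transposed relation. *)
Lemma coarse_graph_of_map (A A' : nonempty_subset G)
    (Y : set (subset_ballean A)) (Y' : set (subset_ballean A'))
    (Y0 : Y !=set0) (Y'0 : Y' !=set0)
    (f : subballean Y0 -> subballean Y'0) R :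
    large Y -> coarse f ->
    (forall x x', R x x' <->
      exists y : Y, x = val (val y) /\ x' = val (val (f y))) ->
  coarse_graph (proj1_sig A) R.
Proof.
move=> [a Ya] fcoarse RE; split.
- by move=> x x' /RE[y [-> _]]; exact: set_valP.
- by move=> x x' x'' /RE[y [-> ->]] /RE[z [/val_inj/val_inj -> ->]].
- move=> F; have [F' hF'] := fcoarse F.
  exists (1 |` F')%fset => x x' y y' /RE[v [-> ->]] /RE[w [-> ->]] vw.
  apply/group_ballP; apply: (hF' v); exists w => //=.
  by apply/group_ballP; rewrite in_fset1U vw orbT.
- exists (1 |` a)%fset => x Ax.
  have [y Yy xy] : bball_set Y a (SigSub (mem_set Ax)) by rewrite Ya.
  exists (val y), (val (val (f (SigSub (mem_set Yy))))); split.
    by apply/RE; exists (SigSub (mem_set Yy)).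
  exact/group_ballP.
Qed.

Lemma coarsely_equivalent_graph (A A' : nonempty_subset G) :
    coarsely_equivalent (subset_ballean A) (subset_ballean A') ->
  exists R, coarse_graph (proj1_sig A) R /\
            coarse_graph (proj1_sig A') (fun x' x => R x x').
Proof.
move=> [Y [Y' [Y0 [Y'0 [Yl Y'l [f [g [fK gK fc gc]]]]]]]].
exists (fun x x' => exists y : Y, x = val (val y) /\ x' = val (val (f y))).
split; first exact: (coarse_graph_of_map Yl fc).
apply: (coarse_graph_of_map Y'l gc) => x' x; split=> [[y [-> ->]]|[y' [-> ->]]].
  by exists (f y); rewrite fK.
by exists (g y'); rewrite gK.
Qed.

End Group.

Lemma coarsely_equivalent_refl (B : ballean) : coarsely_equivalent B B.
Proof.
have [x] := support_nonempty B; have [a] := radii_nonempty B.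
have B0 : [set: B] !=set0 by exists x.
have Bl : large [set: B].
  by exists a; apply/seteqP; split=> // y _; exists y => //; apply: bball_center.
exists setT, setT, B0, B0; split=> //; exists id, id; split=> // r.
all: by exists r => y _ [z yz <-].
Qed.

Theorem mainTheorem1 (G : groupType) (G_countably_infinite : [set: G] #= [set: nat]) :
  coarse_subsets G #= [set: set nat].
Proof.
have [c] := card_set_bijP G_countably_infinite.
rewrite setTT_bijective => -[e cK eK].
apply/card_eqPle; split.
  (* Upper bound: the enumeration codes subsets of [G] as sets of naturals. *)
  apply: card_le_trans (card_image_le _ _) _; apply/pcard_injP.
  exists (fun A => [set n | proj1_sig A (e n)]) => A A' _ _ /= eqA.
  case: A A' eqA => [A A0] [A' A'0] /= eqA; apply: eq_exist; apply/funext => g.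
  by move/(congr1 (fun S : set nat => S (c g))): eqA; rewrite /mkset !cK.
have [P Ptower] := tower_exists eK.
have [x Kscat] := scattered_exists eK cK (fun i => P (logn 2 i)).
pose K i := [fset (p * x i)%g | p in P (logn 2 i)]%fset.
pose union S := [set g | exists2 i, S (logn 2 (logn 2 i)) & g \in K i].
(* Adjoining a label to [S] keeps the union non-empty when [S] is empty. *)
pose succ0 (S : set nat) : set nat := [set n | if n is m.+1 then S m else True].
have union0 S : union (succ0 S) !=set0.
  have [P0 _ _ _] := Ptower.
  have /fset0Pn[p pP] : P (logn 2 1) != fset0 by rewrite -cardfs_gt0 P0.
  by exists (p * x 1%N)%g; exists 1 => //; apply/imfsetP; exists p.
pose A S : nonempty_subset G := exist _ (union (succ0 S)) (union0 S).
have subAA S T :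
    coarsely_equivalent (subset_ballean (A S)) (subset_ballean (A T)) ->
    S `<=` T.
  move=> /coarsely_equivalent_graph[R [RS RT]] m Sm.
  have sub := @block_match _ P (logn 2) x Ptower Kscat logn2_fiber
    (succ0 S) (succ0 T) R RS RT.
  exact: (sub m.+1 Sm).
(* Lower bound: by reflexivity, equal classes give coarse equivalences in both directions, hence
   both inclusions. *)
have Ainj : {in [set: set nat] &, injective (fun S => coarse_class (A S))}.
  move=> S T _ _ /= ST; apply/seteqP; split; apply: subAA.
    rewrite -[coarsely_equivalent _ _]/(coarse_class (A S) (A T)) ST.
    exact: coarsely_equivalent_refl.
  rewrite -[coarsely_equivalent _ _]/(coarse_class (A T) (A S)) -ST.
  exact: coarsely_equivalent_refl.
rewrite -(card_le_eql (inj_card_eq Ainj)); apply: subset_card_le.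
by move=> _ [S _ <-]; exists (A S).
Qed.
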